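(* Let $G=\{f_1,\dots,f_r\}\subset F_0=R^s$ be a Gröbner basis with respect to $>$ consisting of non-zero vectors, let $\succ$ be the monomial ordering on $F_1=R^r$ induced by $>$ and $G$, and let $\sigma\in \mathrm{L}_\succ(\mathrm{Syz}(G))\subset F_1$ be a (non-zero) leading syzygy term. Consider the following procedure (LiftHybrid). 1. Set $g:=\psi(\sigma)-\mathrm{LOT}(\psi(\sigma)\mid G)$ and $\bar\sigma:=\sigma$. 2. While $g\neq 0$: choose any (non-zero) term $t$ of $g$; choose any term $m\,\mathrm{e}_i\in F_1$ (with $m$ a term of $R$) such that $m\,\mathrm{LT}(f_i)=t$ and $\sigma\succ m\,\mathrm{e}_i$; replace $g$ by $g-\bigl(m f_i-\mathrm{LOT}(m f_i\mid G)\bigr)$ and replace $\bar\sigma$ by $\bar\sigma-m\,\mathrm{e}_i$. 3. Return $\bar\sigma$. Then the choices required in step 2 are always possible, the procedure terminates for every sequence of such choices, and the returned element $\bar\sigma$ is a lifting of $\sigma$ with respect to $G$ and $\succ$, that is, $\mathrm{LT}_\succ(\bar\sigma)=\sigma$ and $\bar\sigma\in\mathrm{Syz}(G)$.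
   Context: $K$ is a field and $R=K[x_1,\dots,x_n]$. For a free module $F=R^k$ with canonical basis $\mathrm{e}_1,\dots,\mathrm{e}_k$, a monomial of $F$ is a product $m\,\mathrm{e}_i$ with $m$ a monomial of $R$, and a term is a monomial times a scalar in $K$ (non-zero unless stated otherwise). The monomial $m_1\mathrm{e}_i$ divides $m_2\mathrm{e}_j$ if $i=j$ and $m_1$ divides $m_2$; divisibility of terms ignores non-zero coefficients. A monomial ordering on $F$ is a total ordering $>$ on the monomials of $F$ such that $m_1\mathrm{e}_i>m_2\mathrm{e}_j$ implies $mm_1\mathrm{e}_i>mm_2\mathrm{e}_j$ for every monomial $m$ of $R$, and such that $m_1\mathrm{e}_i>m_2\mathrm{e}_i\iff m_1\mathrm{e}_j>m_2\mathrm{e}_j$ for all $i,j$. It thus determines a unique compatible monomial ordering on $R$; all orderings are assumed global, i.e. this ordering on $R$ is global ($1$ is the smallest monomial). Terms are compared via their underlying monomials. $\mathrm{LM}$, $\mathrm{LT}$ denote leading monomial and leading term (including coefficient). $>$ is a monomial ordering on $F_0=R^s$. $G$ is a Gröbner basis means that it is a Gröbner basis of the submodule $\langle G\rangle_R\subset F_0$ it generates. The map $\psi:F_1=R^r\to F_0$ is the $R$-linear map with $\psi(\mathrm{e}_i)=f_i$, and $\mathrm{Syz}(G)=\ker\psi$. The ordering $\succ$ on $F_1$ induced by $>$ and $G$ is given by $m_1\mathrm{e}_i\succ m_2\mathrm{e}_j$ if and only if $\mathrm{LM}(m_1f_i)>\mathrm{LM}(m_2f_j)$, or $\mathrm{LM}(m_1f_i)=\mathrm{LM}(m_2f_j)$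 and $i>j$. $\mathrm{L}_\succ(\mathrm{Syz}(G))$ is the submodule of $F_1$ generated by the leading monomials with respect to $\succ$ of the non-zero elements of $\mathrm{Syz}(G)$; a leading syzygy term is a term of $F_1$ lying in it. A term $t\in F_0$ is a lower order term with respect to $G$ if $\mathrm{LM}(f)\nmid t$ for all $f\in G$. For $g\in F_0$, $\mathrm{LOT}(g\mid G)$ is the sum of those terms occurring in $g$ that are of lower order with respect to $G$. *)

(* Defs.v *)
From mathcomp Require Import all_boot all_algebra.
From mathcomp Require Export mpoly.
From Stdlib Require Export Relation_Operators.

Set Implicit Arguments.
Unset Strict Implicit.
Unset Printing Implicit Defensive.

Import GRing.Theory.
Local Open Scope ring_scope.

(* R^k is the type of row vectors 'rV[{mpoly K[n]}]_k.  The pair (u, i)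
   stands for the monomial x^u e_i of R^k. *)
Definition mon (n k : nat) : Type := ('X_{1..n} * 'I_k)%type.

Definition basis_vec (K : fieldType) (n k : nat) (i : 'I_k) :
  'rV[{mpoly K[n]}]_k := delta_mx 0 i.

Definition term (K : fieldType) (n k : nat) (c : K) (a : mon n k) :
  'rV[{mpoly K[n]}]_k := (c *: 'X_[a.1]) *: basis_vec K n a.2.

Definition is_term (K : fieldType) (n k : nat) (t : 'rV[{mpoly K[n]}]_k) :=
  exists (c : K) (a : mon n k), c != 0 /\ t = term c a.

Definition is_ring_term (K : fieldType) (n : nat) (m : {mpoly K[n]}) :=
  exists (c : K) (u : 'X_{1..n}), c != 0 /\ m = c *: 'X_[u].

Definition mon_dvd (n k : nat) (a b : mon n k) : bool :=
  (a.2 == b.2) && (a.1 <= b.1)%MM.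

Definition coef (K : fieldType) (n k : nat) (v : 'rV[{mpoly K[n]}]_k)
  (a : mon n k) : K := (v 0 a.2)@_(a.1).

Definition supp (K : fieldType) (n k : nat) (v : 'rV[{mpoly K[n]}]_k) :
  seq (mon n k) := [seq (u, i) | i <- enum 'I_k, u <- msupp (v 0 i)].

Definition term_of (K : fieldType) (n k : nat) (g t : 'rV[{mpoly K[n]}]_k) :=
  exists2 a, a \in supp g & t = term (coef g a) a.

(* A relation o a b is read a > b; orderings are strict. *)
Record global_monomial_ordering (n k : nat) (o : rel (mon n k)) : Prop := {
  mo_irr : irreflexive o;
  mo_trans : transitive o;
  mo_total : forall a b, a != b -> o a b || o b a;
  mo_mul : forall (m : 'X_{1..n}) (a b : mon n k),
    o a b -> o ((m + a.1)%MM, a.2) ((m + b.1)%MM, b.2);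
  mo_compat : forall (m1 m2 : 'X_{1..n}) (i j : 'I_k),
    o (m1, i) (m2, i) = o (m1, j) (m2, j);
  mo_global : forall (m : 'X_{1..n}) (i : 'I_k),
    m != 0%MM -> o (m, i) (0%MM, i) }.

(* For a total ordering, None exactly when v = 0. *)
Definition LM (K : fieldType) (n k : nat) (o : rel (mon n k))
  (v : 'rV[{mpoly K[n]}]_k) : option (mon n k) :=
  ohead [seq a <- supp v | all (fun b => (b == a) || o a b) (supp v)].

Definition LT (K : fieldType) (n k : nat) (o : rel (mon n k))
  (v : 'rV[{mpoly K[n]}]_k) : 'rV[{mpoly K[n]}]_k :=
  if LM o v is Some a then term (coef v a) a else 0.

(* LM v > LM w; on terms, the comparison of their underlying monomials. *)
Definition LM_gt (K : fieldType) (n k : nat) (o : rel (mon n k))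
  (v w : 'rV[{mpoly K[n]}]_k) : bool :=
  if (LM o v, LM o w) is (Some a, Some b) then o a b else false.

Definition submodule_gen (K : fieldType) (n k : nat)
  (S : 'rV[{mpoly K[n]}]_k -> Prop) (v : 'rV[{mpoly K[n]}]_k) : Prop :=
  exists l : seq ({mpoly K[n]} * 'rV[{mpoly K[n]}]_k),
    (forall p, p \in l -> S p.2) /\ v = \sum_(p <- l) p.1 *: p.2.

Definition leading_module (K : fieldType) (n k : nat) (o : rel (mon n k))
  (S : 'rV[{mpoly K[n]}]_k -> Prop) : 'rV[{mpoly K[n]}]_k -> Prop :=
  submodule_gen (fun w => exists v a,
    [/\ S v, v != 0, LM o v = Some a & w = term 1 a]).

(* G = {f_1, ..., f_r} is given as the family f. *)
Definition family_set (K : fieldType) (n s r : nat)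
  (f : 'I_r -> 'rV[{mpoly K[n]}]_s) (v : 'rV[{mpoly K[n]}]_s) : Prop :=
  exists i, v = f i.

(* L(<G>) = L(G). *)
Definition groebner_basis (K : fieldType) (n s r : nat) (o : rel (mon n s))
  (f : 'I_r -> 'rV[{mpoly K[n]}]_s) : Prop :=
  forall v, leading_module o (submodule_gen (family_set f)) v <->
            leading_module o (family_set f) v.

Definition psi (K : fieldType) (n s r : nat)
  (f : 'I_r -> 'rV[{mpoly K[n]}]_s) (v : 'rV[{mpoly K[n]}]_r) :
  'rV[{mpoly K[n]}]_s := \sum_i v 0 i *: f i.

Definition Syz (K : fieldType) (n s r : nat)
  (f : 'I_r -> 'rV[{mpoly K[n]}]_s) (v : 'rV[{mpoly K[n]}]_r) : Prop :=
  psi f v = 0.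

Definition induced_ordering (K : fieldType) (n s r : nat) (o : rel (mon n s))
  (f : 'I_r -> 'rV[{mpoly K[n]}]_s) : rel (mon n r) := fun a b =>
  let va := 'X_[a.1] *: f a.2 in
  let vb := 'X_[b.1] *: f b.2 in
  LM_gt o va vb || ((LM o va == LM o vb) && (b.2 < a.2)%N).

Definition lower_order (K : fieldType) (n s r : nat) (o : rel (mon n s))
  (f : 'I_r -> 'rV[{mpoly K[n]}]_s) (a : mon n s) : bool :=
  [forall i, if LM o (f i) is Some b then ~~ mon_dvd b a else true].

Definition LOT (K : fieldType) (n s r : nat) (o : rel (mon n s))
  (f : 'I_r -> 'rV[{mpoly K[n]}]_s) (g : 'rV[{mpoly K[n]}]_s) :
  'rV[{mpoly K[n]}]_s :=
  \sum_(a <- supp g | lower_order o f a) term (coef g a) a.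

Definition lifting (K : fieldType) (n s r : nat) (o : rel (mon n s))
  (f : 'I_r -> 'rV[{mpoly K[n]}]_s) (sigma sbar : 'rV[{mpoly K[n]}]_r) : Prop :=
  LT (induced_ordering o f) sbar = sigma /\ Syz f sbar.

(* A state of LiftHybrid is the pair (g, sbar) of its two variables. *)
Definition state (K : fieldType) (n s r : nat) : Type :=
  ('rV[{mpoly K[n]}]_s * 'rV[{mpoly K[n]}]_r)%type.

Definition init_state (K : fieldType) (n s r : nat) (o : rel (mon n s))
  (f : 'I_r -> 'rV[{mpoly K[n]}]_s) (sigma : 'rV[{mpoly K[n]}]_r) :
  state K n s r :=
  (psi f sigma - LOT o f (psi f sigma), sigma).

Definition admissible (K : fieldType) (n s r : nat) (o : rel (mon n s))
  (f : 'I_r -> 'rV[{mpoly K[n]}]_s) (sigma : 'rV[{mpoly K[n]}]_r)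
  (t : 'rV[{mpoly K[n]}]_s) (m : {mpoly K[n]}) (i : 'I_r) : Prop :=
  [/\ is_ring_term m, m *: LT o (f i) = t &
      LM_gt (induced_ordering o f) sigma (m *: basis_vec K n i)].

Definition step (K : fieldType) (n s r : nat) (o : rel (mon n s))
  (f : 'I_r -> 'rV[{mpoly K[n]}]_s) (sigma : 'rV[{mpoly K[n]}]_r)
  (st st' : state K n s r) : Prop :=
  st.1 != 0 /\
  exists t m i,
    [/\ term_of st.1 t,
        admissible o f sigma t m i &
        st' = (st.1 - (m *: f i - LOT o f (m *: f i)),
               st.2 - m *: basis_vec K n i)].

Definition reachable (K : fieldType) (n s r : nat) (o : rel (mon n s))
  (f : 'I_r -> 'rV[{mpoly K[n]}]_s) (sigma : 'rV[{mpoly K[n]}]_r)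
  (st : state K n s r) : Prop :=
  clos_refl_trans _ (step o f sigma) (init_state o f sigma) st.

(* Main.v *)
(** Throughout the procedure [g = psi sbar - LOT (psi sbar)] and [sbar] is [sigma]
    plus smaller terms.  At [g = 0] the element [psi sbar] of the submodule
    generated by [G] consists of lower order terms only, hence vanishes since [G]
    is a Gröbner basis.  A monomial of [g] is at most [LM (psi sigma)].  If it is
    smaller, any [LM (f i)] dividing it is admissible.  If it is equal, an
    admissible index exists because [LM (psi sigma)] has to cancel in a syzygy
    led by a divisor of [sigma].  A step cancels a monomial of [g] and changes [g]
    only below it; this terminates because Dickson's lemma makes the ordering
    well-founded. *)

Require Import Defs.
From mathcomp Require Import all_boot all_algebra.
From Stdlib Require Import ClassicalEpsilon.

Set Implicit Arguments.
Unset Strict Implicit.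
Unset Printing Implicit Defensive.

Import GRing.Theory.
Local Open Scope ring_scope.

Local Notation vec K n k := 'rV[{mpoly K[n]}]_k.

(** * Coefficients and supports in free modules *)

Section Coefficients.
Context {K : fieldType} {n k : nat}.
Implicit Types (v w : vec K n k) (a b : mon n k).

Lemma coefD v w a : coef (v + w) a = coef v a + coef w a.
Proof. by rewrite /coef mxE mcoeffD. Qed.

Lemma coefB v w a : coef (v - w) a = coef v a - coef w a.
Proof. by rewrite /coef !mxE mcoeffB. Qed.

Lemma coef0 a : coef (0 : vec K n k) a = 0.
Proof. by rewrite /coef mxE mcoeff0. Qed.

Lemma coef_sum I (r : seq I) (P : pred I) (F : I -> vec K n k) a :
  coef (\sum_(i <- r | P i) F i) a = \sum_(i <- r | P i) coef (F i) a.
Proof.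
exact: (big_morph (fun v => coef v a) (fun v w => coefD v w a) (coef0 a)).
Qed.

Lemma vec_eqP v w : (forall a, coef v a = coef w a) -> v = w.
Proof.
move=> vw; apply/rowP => i; apply/mpolyP => u; exact: (vw (u, i)).
Qed.

Lemma coef_term c a b :
  coef (term c a : vec K n k) b = if b == a then c else 0.
Proof.
case: a b => [u i] [v j]; rewrite /coef !mxE /= xpair_eqE [v == u]eq_sym.
case: (j == i); rewrite ?andbT ?andbF ?mulr0 ?mcoeff0 //.
by rewrite mulr1 mcoeffZ mcoeffX; case: eqP; rewrite ?mulr1 ?mulr0.
Qed.

Lemma mem_supp v a : (a \in supp v) = (coef v a != 0).
Proof.
case: a => u i; rewrite -mcoeff_msupp; apply/allpairsPdep/idP => /=.
  by case=> j [w [_ w_in [-> ->]]].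
by move=> u_in; exists i, u; rewrite mem_enum.
Qed.

Lemma supp_uniq v : uniq (supp v).
Proof.
apply: allpairs_uniq_dep => [|i _|]; [exact: enum_uniq | exact: msupp_uniq |].
by move=> [i x] [j y] _ _ /= [-> ->].
Qed.

Lemma supp_neq0 v : v != 0 -> exists a, coef v a != 0.
Proof.
move=> v0; case E: (supp v) => [|a s].
  case/eqP: v0; apply: vec_eqP => a; rewrite coef0.
  by apply/eqP; rewrite -[_ == _]negbK -mem_supp E.
by exists a; rewrite -mem_supp E mem_head.
Qed.

Lemma coef_scale_neq0 (m : {mpoly K[n]}) v a : coef (m *: v) a != 0 ->
  exists u b, [/\ m@_u != 0, coef v b != 0 & a = ((u + b.1)%MM, b.2)].
Proof.
case: a => u i; rewrite /coef mxE -mcoeff_msupp => /msuppM_le /allpairsP.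
case=> [[u1 u2] /= [u1_in u2_in ->]]; exists u1, (u2, i).
by rewrite -!mcoeff_msupp.
Qed.

Lemma coef_scaleX c u v b :
  coef ((c *: 'X_[u]) *: v) ((u + b.1)%MM, b.2) = c * coef v b.
Proof.
by rewrite /coef mxE /= -scalerAl mcoeffZ [_ * v 0 _]mulrC mcoeffMX.
Qed.

(** [supp g] has no repetitions, so at most the summand indexed by [a] contributes. *)
Lemma coef_LOT r (o : rel (mon n k)) (f : 'I_r -> vec K n k) g a :
  coef (LOT o f g) a = if lower_order o f a then coef g a else 0.
Proof.
rewrite /LOT coef_sum.
under eq_bigr => b _ do rewrite coef_term.
rewrite big_mkcond /=; have [a_in|a_notin] := boolP (a \in supp g).
  rewrite (bigD1_seq a) ?supp_uniq //= eqxx big1 ?addr0 // => b ba.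
  by rewrite eq_sym (negPf ba) if_same.
have -> : coef g a = 0.
  by apply/eqP; move: a_notin; rewrite mem_supp negbK.
rewrite if_same big_seq big1 // => b b_in; case: eqP => [ab|]; last by rewrite if_same.
by rewrite ab b_in in a_notin.
Qed.

End Coefficients.

(** * Leading monomials for a strict total ordering *)

Section LeadingMonomials.
Context {K : fieldType} {n k : nat} (o : rel (mon n k)).
Hypotheses (o_irr : irreflexive o) (o_trans : transitive o).
Hypothesis o_total : forall a b, a != b -> o a b || o b a.
Implicit Types (v : vec K n k) (a b : mon n k).

(** [LM] picks the first maximal entry of the support. Two distinct maximal entries would exceed
    each other, against irreflexivity, so being first is immaterial. *)
Lemma LM_SomeP v a :
  LM o v = Some a <-> coef v a != 0 /\ forall b, coef v b != 0 -> b = a \/ o a b.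
Proof.
rewrite /LM; set P := fun a => all _ (supp v).
have PP c : c \in supp v -> P c <-> forall b, coef v b != 0 -> b = c \/ o c b.
  move=> _; split => [/allP Pc b|Pc]; last apply/allP => b.
    by rewrite -mem_supp => /Pc /orP[/eqP|]; [left | right].
  by rewrite mem_supp => /Pc[->|->]; rewrite ?eqxx ?orbT.
split.
  case E: [seq _ <- _ | _] => [|b s] //= [<-].
  have: b \in [seq a <- supp v | P a] by rewrite E mem_head.
  rewrite mem_filter => /andP[Pb b_in].
  by rewrite -mem_supp; split=> //; apply/PP.
case=> va amax.
have : a \in [seq a <- supp v | P a].
  by rewrite mem_filter mem_supp va andbT; apply/PP; rewrite ?mem_supp.
case E: [seq _ <- _ | _] => [|b s] //= _.
have: b \in [seq a <- supp v | P a] by rewrite E mem_head.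
rewrite mem_filter => /andP[Pb b_in]; move/PP: Pb => /(_ b_in a va).
case=> [->//|ba]; rewrite mem_supp in b_in.
case: (amax b b_in) => [->//|ab].
by have := o_trans ab ba; rewrite o_irr.
Qed.

Lemma LM_exists v : v != 0 -> exists a, LM o v = Some a.
Proof.
move=> /supp_neq0 [a0]; rewrite -mem_supp => a0_in.
suff [a a_in amax] : exists2 a, a \in supp v &
    forall b, b \in supp v -> b = a \/ o a b.
  exists a; apply/LM_SomeP; rewrite -mem_supp; split=> // b.
  by rewrite -mem_supp; apply: amax.
(* [a0] serves only to witness that the list is non-empty. *)
elim: (supp v) a0 a0_in => // c s IH _ _.
case: s IH => [_|d s /(_ d (mem_head _ _)) [a a_in amax]].
  by exists c; rewrite ?mem_head // => b; rewrite inE => /eqP; left.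
have [ac|ca] : (o a c) \/ (a = c \/ o c a).
  by have [->|/o_total/orP[]] := eqVneq a c; auto.
  exists a; first by rewrite inE a_in orbT.
  by move=> b; rewrite inE => /orP[/eqP->|/amax]; [right|].
exists c; rewrite ?mem_head // => b; rewrite inE => /orP[/eqP|/amax]; first by left.
case: ca => [->//|ca] [->|ab]; right=> //; exact: o_trans ca ab.
Qed.

Lemma LM_gtP v w a b : LM o v = Some a -> LM o w = Some b ->
  LM_gt o v w = o a b.
Proof. by rewrite /LM_gt => -> ->. Qed.

Lemma LM_term c a : c != 0 -> LM o (term c a : vec K n k) = Some a.
Proof.
move=> c0; apply/LM_SomeP; rewrite coef_term eqxx; split=> // b.
by rewrite coef_term; have [->|] := eqVneq b a; [left | rewrite eqxx].
Qed.

Lemma LT_eq v a : LM o v = Some a -> LT o v = term (coef v a) a.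
Proof. by rewrite /LT => ->. Qed.

(** A monomial present in a sum is present in some summand, and each summand is a polynomial
    multiple of a single leading monomial. *)
Lemma leading_module_dvd (S : vec K n k -> Prop) v a :
  leading_module o S v -> coef v a != 0 ->
  exists w b, [/\ S w, w != 0, LM o w = Some b & mon_dvd b a].
Proof.
case=> l [lS ->]; rewrite coef_sum => va.
have [p p_in pa] : exists2 p, p \in l & coef (p.1 *: p.2) a != 0.
  apply/hasP; apply: contraNT va => /hasPn l0; rewrite big_seq big1 //.
  by move=> p /l0; rewrite negbK => /eqP.
have [w [b [Sw w0 wb p2]]] := lS p p_in; exists w, b; split=> //.
case: (coef_scale_neq0 pa) => u [b' [_]]; rewrite p2 coef_term.
have [-> _ ->|] := eqVneq b' b; last by rewrite eqxx.
by rewrite /mon_dvd /= eqxx lem_addl.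
Qed.

End LeadingMonomials.

(** * Dickson's lemma and well-foundedness of global orderings *)

Lemma nondecreasing_subsequence (v : nat -> nat) :
  exists phi : nat -> nat, {homo phi : i j / (i < j)%N} /\
    {homo v \o phi : i j / (i <= j)%N}.
Proof.
(* Every tail of [v] attains its minimum: move on to a smaller value while there is one. *)
have tail_min N : exists M, (N <= M)%N /\ forall k, (M <= k)%N -> (v M <= v k)%N.
  have [m] := ubnP (v N); elim: m N => // m IH N vN.
  case: (classic (exists2 k, (N <= k)%N & (v k < v N)%N)) => [[k Nk vk]|Nmin].
    case: (IH k (leq_trans vk vN)) => M [kM Mmin].
    by exists M; split=> //; exact: leq_trans kM.
  exists N; split=> // k Nk; rewrite leqNgt; apply/negP => vk.
  by apply: Nmin; exists k.
pose nxt N := proj1_sig (constructive_indefinite_description _ (tail_min N)).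
have nxtP N : (N <= nxt N)%N /\ forall k, (nxt N <= k)%N -> (v (nxt N) <= v k)%N.
  by rewrite /nxt; case: constructive_indefinite_description.
(* Successive minima of tails, each tail starting just after the previous minimum. *)
pose phi := fix phi k := if k is j.+1 then nxt (phi j).+1 else nxt 0%N.
have phi_lt : {homo phi : i j / (i < j)%N}.
  apply: homo_ltn => [|i]; first exact: ltn_trans.
  by case: (nxtP (phi i).+1).
exists phi; split=> //; apply: homo_leq => //; first exact: leq_trans.
move=> i; have [_ vmin] : (phi i <= phi i)%N /\
    forall k, (phi i <= k)%N -> (v (phi i) <= v k)%N.
  by split=> //; case: i => [|i]; apply: (nxtP _).2.
by apply/vmin/ltnW/phi_lt.
Qed.

(** Thin out the sequence once per coordinate; monotonicity in the coordinates already treated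
    survives. Arbitrary coordinate functions [c] let the component of a module monomial be encoded
    along with its exponents. *)
Lemma dickson_sequence T (I : finType) (c : I -> T -> nat) (u : nat -> T) :
  exists j k, (j < k)%N /\ forall i, (c i (u j) <= c i (u k))%N.
Proof.
suff [phi [phi_lt cphi]] : exists phi : nat -> nat, {homo phi : i j / (i < j)%N} /\
    {in enum I, forall i, {homo c i \o u \o phi : j k / (j <= k)%N}}.
  exists (phi 0%N), (phi 1%N); split=> [|i]; first exact: phi_lt.
  exact: (cphi i (mem_enum _ _) 0%N 1%N).
elim: (enum I) => [|i s [phi [phi_lt cphi]]]; first by exists id; split=> [j k|].
have [chi [chi_lt cchi]] := nondecreasing_subsequence (c i \o u \o phi).
exists (phi \o chi); split=> [j k /chi_lt/phi_lt //|i'].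
rewrite inE => /orP[/eqP-> //|i'_in j k jk] /=; apply: (cphi i' i'_in).
by move: jk; rewrite leq_eqVlt => /orP[/eqP->|/chi_lt/ltnW].
Qed.

(** A non-accessible monomial starts an infinite descending sequence, by classical choice. Dickson's
    lemma finds in it an earlier monomial dividing a later one, while a global ordering never makes
    a proper multiple smaller. *)
Lemma global_ordering_wf n k (o : rel (mon n k)) :
  global_monomial_ordering o -> well_founded (fun b a => o a b).
Proof.
move=> ho a0; set R := fun b a => _; have [//|a0N] := classic (Acc R a0).
have next (x : {a | ~ Acc R a}) : exists y : {a | ~ Acc R a}, o (sval x) (sval y).
  case: x => a aN /=; case: (classic (exists b, o a b /\ ~ Acc R b)).
    by case=> b [ab bN]; exists (exist _ b bN).
  move=> noex; case: aN; constructor=> b ab; have [//|bN] := classic (Acc R b).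
  by case: noex; exists b.
pose nxt x := proj1_sig (constructive_indefinite_description _ (next x)).
pose u j := sval (iter j nxt (exist _ a0 a0N)).
have u_lt j : o (u j) (u j.+1).
  by rewrite /u /= /nxt; case: constructive_indefinite_description.
(* Monotonicity of both [i] and [k - i] forces the component to be constant. *)
pose c (x : 'I_n + bool) (a : mon n k) : nat :=
  match x with inl j => a.1 j | inr true => a.2 | inr false => (k - a.2)%N end.
have [i [j [ij uij]]] := dickson_sequence c u.
have uji : o (u i) (u j).
  by apply: (homo_ltn (@mo_trans _ _ _ ho)) ij.
have eq2 : (u i).2 = (u j).2.
  apply/val_inj/eqP; rewrite eqn_leq (uij (inr true)) /=.
  by have := uij (inr false); rewrite /= leq_sub2lE // ltnW.
have le1 : ((u i).1 <= (u j).1)%MM by apply/mnm_lepP => l; exact: (uij (inl l)).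
case: (u i) (u j) uji eq2 le1 => [m l] [m' l'] /= uji el le1; rewrite -{}el in uji.
have := submK le1; set d := (m' - m)%MM => m'E.
have [d0|d0] := eqVneq d 0%MM.
  by rewrite -m'E d0 add0m (mo_irr ho) in uji.
(* Multiplying [x^d > 1] by [x^m] puts the later monomial above the earlier one, against [uji]. *)
have := mo_mul ho m (mo_global ho l d0); rewrite /= addm0 [(m + d)%MM]addmC m'E.
by move=> /(mo_trans ho uji); rewrite (mo_irr ho).
Qed.

(** * Termination of the cancellation of arbitrary terms *)

Section Termination.
Context {K : fieldType} {n k : nat} (o : rel (mon n k)).
Hypothesis ho : global_monomial_ordering o.
Implicit Types (g h : vec K n k) (a b : mon n k).

(** What a step does to [g], with the coefficients below [a] left free. As [a] need not be leading,
    the leading monomial may stay the same. *)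
Definition cancels g' g := exists a,
  [/\ coef g a != 0, coef g' a = 0 & forall b, o b a -> coef g' b = coef g b].

(** Outer induction on a bound [A] for the monomials of [g]: vectors strictly below [A] are
    accessible. This starts an inner induction on the part below [A], covering the steps that keep
    the coefficient at [A]; a step that removes it lands strictly below [A]. *)
Lemma cancels_wf : well_founded cancels.
Proof.
have acc0 g : (forall a, coef g a = 0) -> Acc cancels g.
  by move=> g0; constructor=> g' [a []]; rewrite g0 eqxx.
suff accb A g : (forall b, coef g b != 0 -> b = A \/ o A b) -> Acc cancels g.
  move=> g; have [->|g0] := eqVneq g 0; first by apply: acc0 => a; rewrite coef0.
  case: (LM_exists (mo_irr ho) (mo_trans ho) (mo_total ho) g0) => A.
  by case/(LM_SomeP (mo_irr ho) (mo_trans ho)) => _; apply: accb.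
elim/(well_founded_ind (global_ordering_wf ho)): A g => A IH.
have acc_lt g : (forall b, coef g b != 0 -> o A b) -> Acc cancels g.
  move=> gA; have [->|g0] := eqVneq g 0; first by apply: acc0 => a; rewrite coef0.
  case: (LM_exists (mo_irr ho) (mo_trans ho) (mo_total ho) g0) => B.
  by case/(LM_SomeP (mo_irr ho) (mo_trans ho)) => /gA AB; apply: IH.
(* A step either cancels the term at [A] or is a step of the part below [A]. *)
have [low lowE] : exists low : vec K n k -> vec K n k,
    forall g b, coef (low g) b = if b == A then 0 else coef g b.
  exists (fun g => g - term (coef g A) A) => g b.
  by rewrite coefB coef_term; case: eqP => [->|]; rewrite ?subrr ?subr0.
suff acc_low h : Acc cancels h -> forall g, low g = h ->
    (forall b, coef g b != 0 -> b = A \/ o A b) -> Acc cancels g.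
  move=> g gA; apply: (acc_low _ _ _ erefl gA); apply: acc_lt => b.
  by rewrite lowE; have [_|bA /gA[/eqP|//]] := eqVneq b A; rewrite ?eqxx ?(negPf bA).
elim=> {}h _ IHh g gh gA; constructor=> g' [a [ga g'a g'g]].
(* The cancelled [a] is at most [A], so nothing above [A] can appear. *)
have g'A b : coef g' b != 0 -> b = A \/ o A b.
  move=> g'b; have [->|bA] := eqVneq b A; first by left.
  case/orP: (mo_total ho bA) => [oba|]; last by right.
  apply: (gA); rewrite -g'g //.
  by case: (gA a ga) => [->//|]; apply: (mo_trans ho oba).
case: (gA a ga) => [aA|Aa].
  apply: acc_lt => b g'b; case: (g'A b g'b) => // bA.
  by rewrite bA -aA g'a eqxx in g'b.
apply: (IHh (low g') _ g' erefl g'A); exists a; rewrite -gh !lowE.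
have /negPf-> : a != A by apply: contraTneq Aa => ->; rewrite (mo_irr ho).
by split=> // b ba; rewrite !lowE g'g.
Qed.

End Termination.

(** * The induced ordering, the map [psi] and leading syzygies *)

Section LiftHybrid.
Context {K : fieldType} {n s r : nat} {o : rel (mon n s)}.
Context {f : 'I_r -> vec K n s} {lm : 'I_r -> mon n s}.
Hypothesis ho : global_monomial_ordering o.
Hypothesis lmP : forall i, LM o (f i) = Some (lm i).
Implicit Types (a b : mon n s) (x y : mon n r) (v w : vec K n r).

Let oirr := mo_irr ho.
Let otrans := mo_trans ho.
Let ototal := mo_total ho.

(* The leading monomial of psi(x^u e_i). *)
Definition image_mon x : mon n s := ((x.1 + (lm x.2).1)%MM, (lm x.2).2).

Lemma coef_lm i : coef (f i) (lm i) != 0.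
Proof. by case/(LM_SomeP oirr otrans): (lmP i). Qed.

Lemma coef_scaled_le c u i a : coef ((c *: 'X_[u]) *: f i) a != 0 ->
  a = image_mon (u, i) \/ o (image_mon (u, i)) a.
Proof.
case/coef_scale_neq0 => u' [b [+ fb ->]].
rewrite mcoeffZ mcoeffX; have [<- _|] := eqVneq u u'; last by rewrite mulr0 eqxx.
case/(LM_SomeP oirr otrans): (lmP i) => _ /(_ b fb) [->|ob]; first by left.
right; exact: mo_mul ob.
Qed.

Lemma coef_scaled_image_mon c x :
  coef ((c *: 'X_[x.1]) *: f x.2) (image_mon x) = c * coef (f x.2) (lm x.2).
Proof. exact: coef_scaleX. Qed.

Lemma LM_scaled x : LM o ('X_[x.1] *: f x.2) = Some (image_mon x).
Proof.
rewrite -['X_[_]]scale1r; apply/(LM_SomeP oirr otrans); split=> [|b].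
  by rewrite coef_scaled_image_mon mul1r coef_lm.
by case: x => u i; apply: coef_scaled_le.
Qed.

Lemma induced_orderingE x y : induced_ordering o f x y =
  o (image_mon x) (image_mon y) ||
  (image_mon x == image_mon y) && (y.2 < x.2)%N.
Proof. by rewrite /induced_ordering /LM_gt !LM_scaled. Qed.

Lemma induced_irr : irreflexive (induced_ordering o f).
Proof. by move=> x; rewrite induced_orderingE oirr ltnn andbF. Qed.

Lemma induced_trans : transitive (induced_ordering o f).
Proof.
move=> y x z; rewrite !induced_orderingE.
case/orP=> [xy|/andP[/eqP-> xy]].
  by case/orP=> [/(otrans xy)->//|/andP[/eqP<- _]]; rewrite xy.
case/orP=> [->//|/andP[-> yz]]; by rewrite (ltn_trans yz xy) orbT.
Qed.

Lemma induced_le x y : x = y \/ induced_ordering o f x y ->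
  image_mon y = image_mon x \/ o (image_mon x) (image_mon y).
Proof.
case=> [->|]; first by left.
by rewrite induced_orderingE => /orP[|/andP[/eqP->]]; auto.
Qed.

Lemma psiB v w : psi f (v - w) = psi f v - psi f w.
Proof.
by rewrite /psi -sumrB; apply: eq_bigr => i _; rewrite !mxE scalerBl.
Qed.

Lemma psi_scale_basis m i : psi f (m *: basis_vec K n i) = m *: f i.
Proof.
rewrite /psi (bigD1 i) //= big1 => [|j ji]; rewrite !mxE eqxx /= ?eqxx.
  by rewrite mulr1 addr0.
by rewrite (negPf ji) mulr0 scale0r.
Qed.

Lemma psi_submodule v : submodule_gen (family_set f) (psi f v).
Proof.
exists [seq (v 0 i, f i) | i <- enum 'I_r]; split=> [p /mapP[i _ ->]|].
  by exists i.
by rewrite big_map big_enum.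
Qed.

(** Cancellation between summands only removes monomials, so each one left occurs in some [x^u f i]
    with [(u, i)] in the support of [v]. *)
Lemma coef_psi_le v a : coef (psi f v) a != 0 -> exists x,
  coef v x != 0 /\ (a = image_mon x \/ o (image_mon x) a).
Proof.
rewrite coef_sum => va.
have [i _ via] : exists2 i, i \in index_enum 'I_r & coef (v 0 i *: f i) a != 0.
  apply/hasP; apply: contraNT va => /hasPn l0; rewrite big_seq big1 //.
  by move=> p /l0; rewrite negbK => /eqP.
case/coef_scale_neq0: via => u [b [vu fb ->]]; exists (u, i); split=> //.
by apply: (@coef_scaled_le 1 u i); rewrite coef_scaleX mul1r.
Qed.

Lemma lower_orderN a :
  reflect (exists i, mon_dvd (lm i) a) (~~ lower_order o f a).
Proof.
apply: (iffP forallPn) => -[i ia]; exists i; move: ia; rewrite lmP.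
  by rewrite negbK.
by move=> ->.
Qed.

Lemma image_monN x : lower_order o f (image_mon x) = false.
Proof.
apply: negbTE; apply/lower_orderN; exists x.2.
by rewrite /mon_dvd eqxx lem_addl.
Qed.

Lemma mon_dvd_image i a : mon_dvd (lm i) a -> a = image_mon ((a.1 - (lm i).1)%MM, i).
Proof.
by case: a => u j /andP[/eqP/= <- le]; rewrite /image_mon /= submK.
Qed.

(** Otherwise the leading monomial of [psi f v] lies in [L(<G>) = L(G)], so some [LM (f i)] divides
    it and it is not of lower order. *)
Lemma groebner_lower_eq0 v : groebner_basis o f ->
  (forall a, coef (psi f v) a != 0 -> lower_order o f a) -> psi f v = 0.
Proof.
move=> hG vlow; apply/eqP; apply: contraT => v0.
have [a va] := LM_exists oirr otrans ototal v0.
have [v_a _] : coef (psi f v) a != 0 /\ _ := proj1 (LM_SomeP oirr otrans _ _) va.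
have : leading_module o (family_set f) (term 1 a).
  apply/hG; exists [:: (1, term 1 a)]; split=> [p|]; last first.
    by rewrite big_seq1 scale1r.
  by rewrite inE => /eqP->; exists (psi f v), a; split=> //; apply: psi_submodule.
have aa : coef (term 1 a : vec K n s) a != 0 by rewrite coef_term eqxx oner_neq0.
case/leading_module_dvd/(_ aa) => w [b [[i ->] _ + ba]]; rewrite lmP => -[lmb].
have /negP[] : ~~ lower_order o f a by apply/lower_orderN; exists i; rewrite lmb.
exact: vlow.
Qed.

(** Some syzygy [z] has a leading monomial [y] dividing [x]. Since [psi z = 0], the contribution of
    [y] at [image_mon y] is cancelled by a smaller monomial [y'] of [z]. Its image is not below that
    of [y], so the images agree and [y'] has the smaller index. *)
Lemma leading_syzygy_dvd c x : c != 0 ->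
  leading_module (induced_ordering o f) (Syz f) (term c x) ->
  exists i, mon_dvd (lm i) (image_mon x) /\ (i < x.2)%N.
Proof.
move=> c0; have xx : coef (term c x : vec K n r) x != 0 by rewrite coef_term eqxx.
case/leading_module_dvd/(_ xx) => z [y [zsyz _ LMz yx]].
have [zy ymax] := proj1 (LM_SomeP induced_irr induced_trans z y) LMz.
pose z' := z - term (coef z y) y.
have z'E x' : coef z' x' = if x' == y then 0 else coef z x'.
  by rewrite coefB coef_term; case: eqP => [->|]; rewrite ?subrr ?subr0.
have : coef (psi f z') (image_mon y) != 0.
  rewrite psiB zsyz psi_scale_basis coefB coef0 coef_scaled_image_mon sub0r.
  by rewrite oppr_eq0 mulf_neq0 ?coef_lm.
case/coef_psi_le => y' [+ y'y]; rewrite z'E.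
have [_|y'Ny zy'] := eqVneq y' y; first by rewrite eqxx.
case: (ymax y' zy') => [eqy|]; first by rewrite eqy eqxx in y'Ny.
rewrite induced_orderingE => /orP[yy'|/andP[/eqP eqyy' lt]].
  case: y'y => [eqy|y'y]; first by rewrite eqy oirr in yy'.
  by have := otrans yy' y'y; rewrite oirr.
case/andP: yx => /eqP yx2 yx1; exists y'.2; rewrite -yx2; split=> //.
(* [lm y'.2] divides the common image of [y'] and [y], which divides that of [x]. *)
have : mon_dvd (image_mon y) (image_mon x).
  rewrite /mon_dvd /= yx2 eqxx /=; apply/mnm_lepP => j.
  by rewrite !mnmDE leq_add2r (mnm_lepP yx1).
rewrite eqyy' => /andP[/eqP e le]; apply/andP; split; first by apply/eqP.
exact: lepm_trans (lem_addl _ _) le.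
Qed.

(** * Admissible choices, the loop invariant and the effect of a step *)

Lemma scale_term k c d u (a : mon n k) :
  (d *: 'X_[u]) *: (term c a : vec K n k) = term (d * c) ((u + a.1)%MM, a.2).
Proof.
by rewrite /term /= scalerA -scalerAl -scalerAr scalerA mpolyXD.
Qed.

Lemma term_inj k c c' (a a' : mon n k) : c != 0 ->
  term c a = term c' a' :> vec K n k -> a = a' /\ c = c'.
Proof.
move=> c0 e; have := coef_term c a a; rewrite {1}e coef_term eqxx.
by case: eqP => [->|_ c0']; [|rewrite -c0' eqxx in c0].
Qed.

Context (c : K) (x0 : mon n r).
Hypothesis c0 : c != 0.
Let sigma : vec K n r := term c x0.

Lemma admissibleP g a m i : coef g a != 0 ->
  admissible o f sigma (term (coef g a) a) m i -> exists d u,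
  [/\ d != 0, m = d *: 'X_[u], a = image_mon (u, i),
      coef g a = d * coef (f i) (lm i) & induced_ordering o f x0 (u, i)].
Proof.
move=> ga [[d [u [d0 ->]]]]; rewrite (LT_eq (lmP i)) scale_term => /esym.
case/(term_inj ga) => aE gE; rewrite (LM_gtP (a := x0) (b := (u, i))).
- by exists d, u.
- exact: (LM_term induced_irr induced_trans x0 c0).
- exact: (LM_term induced_irr induced_trans (u, i) d0).
Qed.

Lemma admissible_exists g a i : coef g a != 0 ->
  mon_dvd (lm i) a -> induced_ordering o f x0 ((a.1 - (lm i).1)%MM, i) ->
  exists m, admissible o f sigma (term (coef g a) a) m i.
Proof.
move=> ga ia xa; set u := (a.1 - _)%MM in xa.
(* The scalar of the quotient of [t] by [LT o (f i)]; [u] is its exponent. *)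
pose d := coef g a / coef (f i) (lm i).
have d0 : d != 0 by rewrite mulf_neq0 ?invr_eq0 ?coef_lm.
exists (d *: 'X_[u]); split; first by exists d, u.
  rewrite (LT_eq (lmP i)) scale_term divfK ?coef_lm //.
  by congr term; rewrite [RHS](mon_dvd_image ia).
rewrite (LM_gtP (a := x0) (b := (u, i))) //.
  exact: (LM_term induced_irr induced_trans x0 c0).
exact: (LM_term induced_irr induced_trans (u, i) d0).
Qed.

(** The first clause is [g = psi sbar - LOT (psi sbar)] read coefficientwise; the other two amount
    to [LT sbar = sigma]. *)
Definition lift_invariant (st : state K n s r) := [/\
  forall a, coef st.1 a = if lower_order o f a then 0 else coef (psi f st.2) a,
  coef st.2 x0 = c &
  forall x, coef st.2 x != 0 -> x0 = x \/ induced_ordering o f x0 x].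

Lemma lift_invariant_init : lift_invariant (init_state o f sigma).
Proof.
split=> [a||x] /=; last 2 first.
- by rewrite coef_term eqxx.
- by rewrite coef_term; have [->|] := eqVneq x x0; [left | rewrite eqxx].
by rewrite coefB coef_LOT; case: ifP; rewrite ?subrr ?subr0.
Qed.

(** [psi] and [LOT] are additive, so both variables change consistently; the subtracted term lies
    below [sigma] and leaves its coefficient alone. *)
Lemma lift_invariant_step st st' :
  step o f sigma st st' -> lift_invariant st -> lift_invariant st'.
Proof.
case=> _ [t [m [i [[a a_in ->] adm ->]]]] [invg invc invm].
rewrite mem_supp in a_in.
have [d [u [d0 mE aE gE xu]]] := admissibleP a_in adm.
have uNx : (x0 == (u, i)) = false.
  by apply/eqP => e; rewrite e induced_irr in xu.
have mt : m *: basis_vec K n i = term d (u, i) by rewrite mE.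
split=> [b||x] /=.
- rewrite coefB coefB coef_LOT psiB psi_scale_basis coefB invg.
  by case: ifP; rewrite ?subrr ?subr0.
- by rewrite mt coefB coef_term uNx subr0.
rewrite mt coefB coef_term; have [-> _|_] := eqVneq x (u, i); first by right.
by rewrite subr0; apply: invm.
Qed.

Lemma lift_invariant_reachable st : reachable o f sigma st -> lift_invariant st.
Proof.
rewrite /reachable; move: lift_invariant_init; move: (init_state _ _ _) => st0 + h.
elim: h => [x y /lift_invariant_step//|//|x y z _ IHxy _ IHyz /IHxy/IHyz//].
Qed.

(** [m *: f i] has leading term [t], whose monomial is an image and hence not of lower order; so
    [LOT] does not remove it and the subtraction kills it. *)
Lemma step_cancels st st' : step o f sigma st st' -> cancels o st'.1 st.1.
Proof.
case=> _ [t [m [i [[a a_in ->] adm ->]]]]; rewrite mem_supp in a_in.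
have [d [u [d0 mE aE gE xu]]] := admissibleP a_in adm.
exists a; split=> //= [|b ba].
  rewrite coefB coefB coef_LOT mE {2 3 4}aE image_monN subr0.
  by rewrite (coef_scaled_image_mon d (u, i)) gE subrr.
have fb : coef (m *: f i) b = 0.
  apply/eqP; apply: contraT; rewrite mE => /coef_scaled_le; rewrite -aE.
  case=> [e|ab]; first by rewrite e oirr in ba.
  by have := otrans ab ba; rewrite oirr.
by rewrite coefB coefB coef_LOT fb if_same !subr0.
Qed.

Lemma lift_choice st t : leading_module (induced_ordering o f) (Syz f) sigma ->
  lift_invariant st -> term_of st.1 t -> exists m i, admissible o f sigma t m i.
Proof.
move=> hL [invg _ invm] [a]; rewrite mem_supp => ga ->.
move: (ga); rewrite {1}invg.
case: (boolP (lower_order o f a)) => [_|/lower_orderN[i ia]]; first by rewrite eqxx.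
case/coef_psi_le => x [/invm /induced_le x0x xa].
have {x x0x xa} : a = image_mon x0 \/ o (image_mon x0) a.
  case: x0x xa => [->//|x0x [->|/(otrans x0x)]]; by right.
(* In case of equality the images tie, so an index below that of [x0] is required; otherwise any
   divisor [lm i] of [a] will do. *)
case=> [ax0|x0a].
  have [j [jx0 jlt]] := leading_syzygy_dvd c0 hL.
  rewrite -ax0 in jx0.
  have xa : induced_ordering o f x0 ((a.1 - (lm j).1)%MM, j).
    by rewrite induced_orderingE -(mon_dvd_image jx0) ax0 eqxx /= jlt orbT.
  by have [m adm] := admissible_exists ga jx0 xa; exists m, j.
have xa : induced_ordering o f x0 ((a.1 - (lm i).1)%MM, i).
  by rewrite induced_orderingE -(mon_dvd_image ia) x0a.
by have [m adm] := admissible_exists ga ia xa; exists m, i.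
Qed.

Lemma lift_final st : groebner_basis o f ->
  lift_invariant st -> st.1 = 0 -> lifting o f sigma st.2.
Proof.
move=> hG [invg invc invm] st0; split.
  rewrite (@LT_eq _ _ _ _ _ x0) ?invc //.
  apply/(LM_SomeP induced_irr induced_trans); rewrite invc; split=> // b.
  by case/invm; auto.
apply: groebner_lower_eq0 => // a; apply: contraNT => /negPf low.
by have := invg a; rewrite st0 coef0 low => <-.
Qed.

End LiftHybrid.

Theorem mainTheorem1 (K : fieldType) (n s r : nat) (o : rel (mon n s))
  (f : 'I_r -> 'rV[{mpoly K[n]}]_s) (sigma : 'rV[{mpoly K[n]}]_r)
  (ho : global_monomial_ordering o)
  (hf : forall i, f i != 0)
  (hG : groebner_basis o f)
  (hsigma : is_term sigma)
  (hL : leading_module (induced_ordering o f) (Syz f) sigma) :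
  [/\ (* the choices are always possible *)
      forall st, reachable o f sigma st -> st.1 != 0 ->
        (exists t, term_of st.1 t) /\
        (forall t, term_of st.1 t -> exists m i, admissible o f sigma t m i),
      (* no sequence of choices runs forever *)
      ~ (exists run : nat -> state K n s r,
           run 0%N = init_state o f sigma /\
           forall k : nat, step o f sigma (run k) (run k.+1)) &
      (* the returned element is a lifting *)
      forall st, reachable o f sigma st -> st.1 = 0 ->
        lifting o f sigma st.2].
Proof.
(* Finite choice over the indices; each [f i] is non-zero. *)
have [lm lmP] : exists lm, forall i, LM o (f i) = Some (lm i).
  apply: (@fin_all_exists _ _ (fun i b => LM o (f i) = Some b)) => i.
  exact: (LM_exists (mo_irr ho) (mo_trans ho) (mo_total ho) (hf i)).
case: hsigma hL => c [x0 [c0 ->]] {}hL.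
have inv := lift_invariant_reachable ho lmP c0.
split=> [st /inv st_inv g0||st /inv st_inv].
- split=> [|t]; last exact: (lift_choice ho lmP c0 hL st_inv).
  have [a ga] := supp_neq0 g0.
  by exists (term (coef st.1 a) a), a; rewrite ?mem_supp.
- case=> run [_ run_step].
  (* Generalizing over the position [j] lets the induction pass from [run j] to [run j.+1]. *)
  suff acc g : Acc (cancels o) g -> forall j, (run j).1 = g -> False.
    exact: (acc _ (cancels_wf ho (run 0%N).1) 0%N erefl).
  elim=> {}g _ IH j gE; apply: (IH _ _ j.+1 erefl); rewrite -gE.
  exact: (step_cancels ho lmP c0 (run_step j)).
exact: (lift_final ho lmP c0 hG st_inv).
Qed.
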